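(* Let $\mathbf{C}$ be a pointed category with finite limits and cokernels, and let $\mathbf{E}$ be the class of all split epimorphisms in $\mathbf{C}$. Then the following conditions are equivalent: (i) the pair $(\mathbf{C},\mathbf{E})$ is a relative weakly homological category; (ii) $\mathbf{C}$ is a protomodular category in the sense of Bourn.
   Context: A category is pointed if it has a zero object. Let $\mathbf{C}$ be a pointed category with finite limits and cokernels, and $\mathbf{E}$ a class of morphisms in $\mathbf{C}$ containing all isomorphisms. The pair $(\mathbf{C},\mathbf{E})$ is called a relative weakly homological category if: (a) the class $\mathbf{E}$ is pullback stable (every pullback of a morphism in $\mathbf{E}$ along an arbitrary morphism is in $\mathbf{E}$); (b) every morphism in $\mathbf{E}$ is a normal epimorphism, i.e. a cokernel of some morphism; (c) the $\mathbf{E}$-short-five lemma holds: whenever $f:A\to B$ and $f':A'\to B$ are in $\mathbf{E}$, $k:K\to A$ is a kernel of $f$, $k':K\to A'$ is a kernel of $f'$, and $w:A\to A'$ satisfies $wk=k'$ and $f'w=f$, the morphism $w$ is an isomorphism; (d) the class $\mathbf{E}$ is closed under composition; (e) if $f\in\mathbf{E}$ and $gf\in\mathbf{E}$, then $g\in\mathbf{E}$. Protomodularity (Bourn): for an object $B$ let $\mathrm{Pt}(B)$ be the category whose objects are triples $(A,p,s)$ with $p:A\to B$, $s:B\to A$, $ps=1_B$, and whose morphisms $(A,p,s)\to(A',p',s')$ are morphisms $w:A\to A'$ with $p'w=p$ and $ws=s'$. A category with finite limits is protomodular if for every morphism $v:B'\to B$ the pullback functor $v^*:\mathrm{Pt}(B)\to\mathrm{Pt}(B')$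 reflects isomorphisms. *)

(* Defs.v *)
From Stdlib Require Import FinFun ClassicalEpsilon List.

Set Implicit Arguments.
Unset Strict Implicit.
Unset Printing Implicit Defensive.

Declare Scope cat_scope.
Delimit Scope cat_scope with cat.

Record Category : Type := {
  Ob :> Type;
  Hom : Ob -> Ob -> Type;
  idm : forall A : Ob, Hom A A;
  comp : forall A B D : Ob, Hom B D -> Hom A B -> Hom A D;
  comp_id_l : forall (A B : Ob) (f : Hom A B), comp (idm B) f = f;
  comp_id_r : forall (A B : Ob) (f : Hom A B), comp f (idm A) = f;
  comp_assoc : forall (A B D X : Ob) (f : Hom A B) (g : Hom B D) (h : Hom D X),
    comp h (comp g f) = comp (comp h g) f
}.

Arguments Hom {_} _ _.
Arguments idm {_} _.
Arguments comp {_} {_ _ _} _ _.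
Arguments comp_id_l {_} {_ _} _.
Arguments comp_id_r {_} {_ _} _.
Arguments comp_assoc {_} {_ _ _ _} _ _ _.

Infix "∘" := comp (at level 40, left associativity) : cat_scope.
Local Open Scope cat_scope.

Record Functor (C D : Category) : Type := {
  fobj :> C -> D;
  fmap : forall A B : C, Hom A B -> Hom (fobj A) (fobj B);
  fmap_id : forall A : C, fmap (idm A) = idm (fobj A);
  fmap_comp : forall (A B X : C) (g : Hom B X) (f : Hom A B),
    fmap (g ∘ f) = fmap g ∘ fmap f
}.

Arguments fmap {C D} _ {A B} _.

Definition is_iso (C : Category) (A B : C) (f : Hom A B) : Prop :=
  exists g : Hom B A, g ∘ f = idm A /\ f ∘ g = idm B.

Definition reflects_isos (C D : Category) (F : Functor C D) : Prop :=
  forall (A B : C) (f : Hom A B), is_iso (fmap F f) -> is_iso f.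

Definition morphism_class (C : Category) : Type :=
  forall A B : C, Hom A B -> Prop.

Definition split_epi (C : Category) : morphism_class C :=
  fun A B p => exists s : Hom B A, p ∘ s = idm B.

Definition is_initial (C : Category) (Z : C) : Prop :=
  forall A : C, exists! f : Hom Z A, True.

Definition is_terminal (C : Category) (Z : C) : Prop :=
  forall A : C, exists! f : Hom A Z, True.

Definition is_zero_object (C : Category) (Z : C) : Prop :=
  is_initial Z /\ is_terminal Z.

Definition pointed (C : Category) : Prop :=
  exists Z : C, is_zero_object Z.

Definition is_zero_mor (C : Category) (A B : C) (f : Hom A B) : Prop :=
  exists (Z : C) (t : Hom A Z) (i : Hom Z B), is_zero_object Z /\ f = i ∘ t.

Definition is_kernel (C : Category) (A B K : C) (f : Hom A B) (k : Hom K A)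
  : Prop :=
  is_zero_mor (f ∘ k) /\
  forall (X : C) (x : Hom X A), is_zero_mor (f ∘ x) ->
    exists! u : Hom X K, k ∘ u = x.

Definition is_cokernel (C : Category) (A B Q : C) (f : Hom A B) (q : Hom B Q)
  : Prop :=
  is_zero_mor (q ∘ f) /\
  forall (X : C) (x : Hom B X), is_zero_mor (x ∘ f) ->
    exists! u : Hom Q X, u ∘ q = x.

Definition has_cokernels (C : Category) : Prop :=
  forall (A B : C) (f : Hom A B),
    exists (Q : C) (q : Hom B Q), is_cokernel f q.

Definition normal_epi (C : Category) : morphism_class C :=
  fun B Q q => exists (A : C) (f : Hom A B), is_cokernel f q.

Definition is_cone (J C : Category) (F : Functor J C) (L : C)
  (pi : forall j : J, Hom L (F j)) : Prop :=
  forall (i j : J) (u : Hom i j), fmap F u ∘ pi i = pi j.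

Definition is_limit (J C : Category) (F : Functor J C) (L : C)
  (pi : forall j : J, Hom L (F j)) : Prop :=
  is_cone pi /\
  forall (X : C) (mu : forall j : J, Hom X (F j)), is_cone mu ->
    exists! h : Hom X L, forall j : J, pi j ∘ h = mu j.

Definition finite_category (J : Category) : Prop :=
  Finite J /\ forall i j : J, Finite (Hom i j).

Definition has_finite_limits (C : Category) : Prop :=
  forall (J : Category) (F : Functor J C), finite_category J ->
    exists (L : C) (pi : forall j : J, Hom L (F j)), is_limit pi.

Definition is_pullback (C : Category) (A B D P : C)
  (f : Hom A D) (g : Hom B D) (p1 : Hom P A) (p2 : Hom P B) : Prop :=
  f ∘ p1 = g ∘ p2 /\
  forall (X : C) (x : Hom X A) (y : Hom X B), f ∘ x = g ∘ y ->
    exists! h : Hom X P, p1 ∘ h = x /\ p2 ∘ h = y.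

Definition short_five (C : Category) (E : morphism_class C) : Prop :=
  forall (A A' B K : C) (f : Hom A B) (f' : Hom A' B)
         (k : Hom K A) (k' : Hom K A') (w : Hom A A'),
    E A B f -> E A' B f' -> is_kernel f k -> is_kernel f' k' ->
    w ∘ k = k' -> f' ∘ w = f -> is_iso w.

Record relative_weakly_homological (C : Category) (E : morphism_class C)
  : Prop := {
  rwh_iso : forall (A B : C) (f : Hom A B), is_iso f -> E A B f;
  rwh_pullback : forall (A B D P : C) (f : Hom A D) (g : Hom B D)
      (p1 : Hom P A) (p2 : Hom P B),
    is_pullback f g p1 p2 -> E A D f -> E P B p2;
  rwh_normal : forall (A B : C) (f : Hom A B), E A B f -> normal_epi f;
  rwh_short_five : short_five E;
  rwh_comp : forall (A B D : C) (f : Hom A B) (g : Hom B D),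
    E A B f -> E B D g -> E A D (g ∘ f);
  rwh_cancel : forall (A B D : C) (f : Hom A B) (g : Hom B D),
    E A B f -> E A D (g ∘ f) -> E B D g
}.

Inductive cospan_ob : Set := cs_left | cs_right | cs_base.

Definition cospan_hom (i j : cospan_ob) : Set :=
  match i, j with
  | cs_left, cs_left | cs_right, cs_right | cs_base, cs_base
  | cs_left, cs_base | cs_right, cs_base => unit
  | _, _ => Empty_set
  end.

Definition cospan_id (i : cospan_ob) : cospan_hom i i :=
  match i with cs_left | cs_right | cs_base => tt end.

Definition cospan_comp (i j l : cospan_ob) :
  cospan_hom j l -> cospan_hom i j -> cospan_hom i l.
Proof. destruct i, j, l; cbn; auto; intros []. Defined.

Definition cospan : Category.
Proof.
  refine (@Build_Category cospan_ob cospan_hom cospan_id cospan_comp _ _ _).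
  - intros [] [] []; reflexivity.
  - intros [] [] []; reflexivity.
  - intros [] [] [] [] [] [] []; reflexivity.
Defined.

Lemma cospan_finite : finite_category cospan.
Proof.
  split.
  - exists (cs_left :: cs_right :: cs_base :: nil). intros []; cbn; auto.
  - intros [] [];
      solve [ exists (tt :: nil); intros []; cbn; auto
            | exists nil; intros [] ].
Qed.

Section CospanDiagram.
Variables (C : Category) (A B D : C) (f : Hom A D) (g : Hom B D).

Definition cospan_diag_ob (i : cospan) : C :=
  match i with cs_left => A | cs_right => B | cs_base => D end.

Definition cospan_diag_map (i j : cospan) :
  Hom i j -> Hom (cospan_diag_ob i) (cospan_diag_ob j) :=
  match i, j return
    cospan_hom i j -> Hom (cospan_diag_ob i) (cospan_diag_ob j) with
  | cs_left, cs_left => fun _ => idm A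
  | cs_right, cs_right => fun _ => idm B
  | cs_base, cs_base => fun _ => idm D
  | cs_left, cs_base => fun _ => f
  | cs_right, cs_base => fun _ => g
  | cs_left, cs_right | cs_right, cs_left
  | cs_base, cs_left | cs_base, cs_right => fun u => match u with end
  end.

Definition cospan_diag : Functor cospan C.
Proof.
  refine (@Build_Functor cospan C cospan_diag_ob cospan_diag_map _ _).
  - intros []; reflexivity.
  - intros [] [] [] [] []; cbn; symmetry;
      first [apply comp_id_l | apply comp_id_r].
Defined.

Lemma pullback_exists : has_finite_limits C ->
  exists (P : C) (p : Hom P A * Hom P B), is_pullback f g (fst p) (snd p).
Proof.
  intros HL. destruct (HL cospan cospan_diag cospan_finite)
    as (P & pi & Hc & Hu).
  exists P, (pi cs_left, pi cs_right). cbn. split.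
  - transitivity (pi cs_base).
    + exact (Hc cs_left cs_base tt).
    + symmetry. exact (Hc cs_right cs_base tt).
  - intros X x y Hxy.
    pose (mu := fun j : cospan =>
      match j return Hom X (cospan_diag j) with
      | cs_left => x | cs_right => y | cs_base => f ∘ x
      end).
    assert (Hmu : is_cone mu).
    { intros [] [] []; cbn; auto using comp_id_l. }
    destruct (Hu X mu Hmu) as (h & Hh & Huniq).
    exists h. split.
    + split; [exact (Hh cs_left) | exact (Hh cs_right)].
    + intros h' [H1 H2]. apply Huniq. intros []; cbn.
      * exact H1.
      * exact H2.
      * rewrite <- (Hc cs_left cs_base tt). cbn.
        rewrite <- comp_assoc. now rewrite H1.
Qed.
End CospanDiagram.

(* Limits are only assumed to exist, whereas the functor [v^*] needs a choice of
   pullbacks; another choice gives a naturally isomorphic functor, which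
   reflects isomorphisms if and only if this one does. *)
Section ChosenPullback.
Variables (C : Category) (HL : has_finite_limits C).
Variables (A B D : C) (f : Hom A D) (g : Hom B D).

Definition pb_sig :
  { P : C | exists p : Hom P A * Hom P B, is_pullback f g (fst p) (snd p) } :=
  constructive_indefinite_description _ (pullback_exists f g HL).

Definition pb : C := proj1_sig pb_sig.

Definition pb_proj :
  { p : Hom pb A * Hom pb B | is_pullback f g (fst p) (snd p) } :=
  constructive_indefinite_description _ (proj2_sig pb_sig).

Definition pb1 : Hom pb A := fst (proj1_sig pb_proj).
Definition pb2 : Hom pb B := snd (proj1_sig pb_proj).

Lemma pb_is_pullback : is_pullback f g pb1 pb2.
Proof. exact (proj2_sig pb_proj). Qed.

Definition pb_lift_sig (X : C) (x : Hom X A) (y : Hom X B)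
  (e : f ∘ x = g ∘ y) :
  { h : Hom X pb | unique (fun h => pb1 ∘ h = x /\ pb2 ∘ h = y) h } :=
  constructive_indefinite_description _ (proj2 pb_is_pullback X x y e).

Definition pb_lift (X : C) (x : Hom X A) (y : Hom X B)
  (e : f ∘ x = g ∘ y) : Hom X pb :=
  proj1_sig (pb_lift_sig e).

Lemma pb_lift1 (X : C) (x : Hom X A) (y : Hom X B) (e : f ∘ x = g ∘ y) :
  pb1 ∘ pb_lift e = x.
Proof. exact (proj1 (proj1 (proj2_sig (pb_lift_sig e)))). Qed.

Lemma pb_lift2 (X : C) (x : Hom X A) (y : Hom X B) (e : f ∘ x = g ∘ y) :
  pb2 ∘ pb_lift e = y.
Proof. exact (proj2 (proj1 (proj2_sig (pb_lift_sig e)))). Qed.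

Lemma pb_ext (X : C) (h h' : Hom X pb) :
  pb1 ∘ h = pb1 ∘ h' -> pb2 ∘ h = pb2 ∘ h' -> h = h'.
Proof.
  intros H1 H2.
  assert (e : f ∘ (pb1 ∘ h') = g ∘ (pb2 ∘ h')).
  { rewrite !comp_assoc. now rewrite (proj1 pb_is_pullback). }
  destruct (proj2 pb_is_pullback X _ _ e) as (u & _ & Hu).
  transitivity u; [symmetry|]; apply Hu; auto.
Qed.
End ChosenPullback.

Record Point (C : Category) (B : C) : Type := {
  pt_ob : C;
  pt_p : Hom pt_ob B;
  pt_s : Hom B pt_ob;
  pt_ps : pt_p ∘ pt_s = idm B
}.

Record PtHom (C : Category) (B : C) (a b : Point B) : Type := {
  pt_mor : Hom (pt_ob a) (pt_ob b);
  pt_mor_p : pt_p b ∘ pt_mor = pt_p a;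
  pt_mor_s : pt_mor ∘ pt_s a = pt_s b
}.

Lemma PtHom_eq (C : Category) (B : C) (a b : Point B) (u v : PtHom a b) :
  pt_mor u = pt_mor v -> u = v.
Proof.
  destruct u as [u up us], v as [v vp vs]; cbn. intros <-.
  now rewrite (proof_irrelevance _ up vp), (proof_irrelevance _ us vs).
Qed.

Definition pt_id (C : Category) (B : C) (a : Point B) : PtHom a a :=
  {| pt_mor := idm (pt_ob a);
     pt_mor_p := comp_id_r (pt_p a);
     pt_mor_s := comp_id_l (pt_s a) |}.

Definition pt_comp (C : Category) (B : C) (a b c : Point B)
  (v : PtHom b c) (u : PtHom a b) : PtHom a c.
Proof.
  refine {| pt_mor := pt_mor v ∘ pt_mor u |}.
  - rewrite comp_assoc, pt_mor_p. apply pt_mor_p.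
  - rewrite <- comp_assoc, pt_mor_s. apply pt_mor_s.
Defined.

Definition Pt (C : Category) (B : C) : Category.
Proof.
  refine (@Build_Category (Point B) (@PtHom C B) (@pt_id C B) (@pt_comp C B)
            _ _ _); intros; apply PtHom_eq; cbn.
  - apply comp_id_l.
  - apply comp_id_r.
  - apply comp_assoc.
Defined.

Section PullbackFunctor.
Variables (C : Category) (HL : has_finite_limits C).
Variables (B' B : C) (v : Hom B' B).

Lemma pb_point_sec (a : Point B) :
  pt_p a ∘ (pt_s a ∘ v) = v ∘ idm B'.
Proof. now rewrite comp_assoc, pt_ps, comp_id_l, comp_id_r. Qed.

Definition pb_point (a : Point B) : Point B' :=
  {| pt_ob := pb HL (pt_p a) v;
     pt_p := pb2 HL (pt_p a) v;
     pt_s := pb_lift HL (pb_point_sec a);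
     pt_ps := pb_lift2 HL (pb_point_sec a) |}.

Lemma pb_point_mor_eq (a b : Point B) (w : PtHom a b) :
  pt_p b ∘ (pt_mor w ∘ pb1 HL (pt_p a) v) = v ∘ pb2 HL (pt_p a) v.
Proof.
  rewrite comp_assoc, pt_mor_p. exact (proj1 (pb_is_pullback HL (pt_p a) v)).
Qed.

Definition pb_point_map (a b : Point B) (w : PtHom a b) :
  PtHom (pb_point a) (pb_point b).
Proof.
  refine (@Build_PtHom C B' (pb_point a) (pb_point b)
            (pb_lift HL (pb_point_mor_eq w)) _ _).
  - apply pb_lift2.
  - cbn. apply pb_ext; rewrite comp_assoc.
    + now rewrite !pb_lift1, <- comp_assoc, pb_lift1, comp_assoc, pt_mor_s.
    + now rewrite !pb_lift2.
Defined.

Definition pullback_functor : Functor (Pt B) (Pt B').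
Proof.
  refine (@Build_Functor (Pt B) (Pt B') pb_point pb_point_map _ _).
  - intros a. apply PtHom_eq. cbn. apply pb_ext.
    + now rewrite pb_lift1, comp_id_l, comp_id_r.
    + now rewrite pb_lift2, comp_id_r.
  - intros a b c g f. apply PtHom_eq. cbn. apply pb_ext.
    + now rewrite pb_lift1, comp_assoc, pb_lift1, <- !comp_assoc, pb_lift1.
    + now rewrite pb_lift2, comp_assoc, !pb_lift2.
Defined.
End PullbackFunctor.

Definition protomodular (C : Category) (HL : has_finite_limits C) : Prop :=
  forall (B' B : C) (v : Hom B' B), reflects_isos (pullback_functor HL v).

(* Main.v *)
Require Import Defs.

(** Both conditions say that a morphism of points over [B] is invertible as soon
    as it is invertible on the fibres over the zero object, that is, on kernels.

    Relative weak homologicity gives protomodularity because the kernel of the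
    pullback of [p] along [v] is, after composing with the projection, again a
    kernel of [p] ([kernel_of_pullback]). If [v^*(w)] is invertible, then [w]
    therefore carries a kernel of [p] to a kernel of [p'], and the short five
    lemma applies.

    Conversely, protomodularity for [v : 0 -> B] yields the short five lemma for
    split epimorphisms ([protomodular_short_five]): a morphism [w] over [B]
    carries a section [s] of [f] to the section [w ∘ s] of [f'], so it is always
    a morphism of points. The only other axiom with content is that a split
    epimorphism [f], with section [s] and kernel [k], is a normal epimorphism.
    If [x ∘ k = 0], then [k] and [s] both factor through the equalizer [m] of [x]
    and [x ∘ s ∘ f], which makes [m] a morphism of points inducing the identity
    on kernels. By the short five lemma [m] is invertible, so
    [x = (x ∘ s) ∘ f], and [f] is the cokernel of [k]. *)

Local Open Scope cat_scope.

(** * Zero morphisms *)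

(** Zero morphisms are defined through some zero object; the choice does not
    matter, since any two zero objects are linked by a unique morphism. *)
Lemma zero_mor_unique (C : Category) (A B : C) (f g : Hom A B) :
  is_zero_mor f -> is_zero_mor g -> f = g.
Proof.
  intros (Z & t & i & [HI _] & ->) (Z' & t' & i' & [_ HT] & ->).
  destruct (HT Z) as (h & _ & _).
  destruct (HT A) as (a & _ & Ha).
  destruct (HI B) as (b & _ & Hb).
  assert (Et : t' = h ∘ t) by (transitivity a; [symmetry|]; now apply Ha).
  assert (Ei : i = i' ∘ h) by (transitivity b; [symmetry|]; now apply Hb).
  now rewrite Et, Ei, comp_assoc.
Qed.

Lemma zero_mor_comp_l (C : Category) (A B D : C) (f : Hom A B) (g : Hom B D) :
  is_zero_mor f -> is_zero_mor (g ∘ f).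
Proof.
  intros (Z & t & i & HZ & ->). exists Z, t, (g ∘ i).
  split; [exact HZ | apply comp_assoc].
Qed.

Lemma zero_mor_comp_r (C : Category) (A B D : C) (f : Hom A B) (g : Hom B D) :
  is_zero_mor g -> is_zero_mor (g ∘ f).
Proof.
  intros (Z & t & i & HZ & ->). exists Z, (t ∘ f), i.
  split; [exact HZ | symmetry; apply comp_assoc].
Qed.

Lemma zero_mor_from_zero (C : Category) (Z B : C) (f : Hom Z B) :
  is_zero_object Z -> is_zero_mor f.
Proof.
  intros HZ. exists Z, (idm Z), f. split; [exact HZ|].
  symmetry; apply comp_id_r.
Qed.

Lemma zero_mor_exists (C : Category) (HZ : pointed C) (A B : C) :
  exists f : Hom A B, is_zero_mor f.
Proof.
  destruct HZ as (Z & HI & HT).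
  destruct (HT A) as (t & _ & _), (HI B) as (i & _ & _).
  exists (i ∘ t), Z, t, i. repeat split; assumption.
Qed.

(** * Kernels *)

Lemma kernel_mono (C : Category) (A B K X : C) (f : Hom A B) (k : Hom K A)
  (u v : Hom X K) :
  is_kernel f k -> k ∘ u = k ∘ v -> u = v.
Proof.
  intros [Hz Hk] E.
  destruct (Hk X (k ∘ v)) as (h & _ & Hh).
  - rewrite comp_assoc. now apply zero_mor_comp_r.
  - transitivity h; [symmetry|]; now apply Hh.
Qed.

(** The kernel of [f] is its pullback along the morphism from a zero object. *)
Lemma kernel_exists (C : Category) (HZ : pointed C) (HL : has_finite_limits C)
  (A B : C) (f : Hom A B) :
  exists (K : C) (k : Hom K A), is_kernel f k.
Proof.
  destruct HZ as (Z & HZ). destruct (proj1 HZ B) as (i & _ & _).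
  destruct (pullback_exists f i HL) as (K & [k t] & Hc & Hu). cbn in Hc, Hu.
  exists K, k. split.
  - rewrite Hc. now apply zero_mor_comp_r, zero_mor_from_zero.
  - intros X x Hx. destruct (proj2 HZ X) as (y & _ & _).
    assert (E : f ∘ x = i ∘ y).
    { apply zero_mor_unique; [exact Hx|].
      now apply zero_mor_comp_r, zero_mor_from_zero. }
    destruct (Hu X x y E) as (h & [H1 _] & Hh).
    exists h. split; [exact H1|]. intros h' E'. apply Hh. split; [exact E'|].
    destruct (proj2 HZ X) as (z & _ & Hz).
    transitivity z; [symmetry|]; now apply Hz.
Qed.

(** Fibres over the zero object are unchanged by pullback, because the morphism
    from a zero object to [D] factors through [g]. *)
Lemma kernel_of_pullback (C : Category) (HZ : pointed C) (A B D P K : C)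
  (f : Hom A D) (g : Hom B D) (p1 : Hom P A) (p2 : Hom P B) (k : Hom K P) :
  is_pullback f g p1 p2 -> is_kernel p2 k -> is_kernel f (p1 ∘ k).
Proof.
  intros [Hc Hu] [Hz Hk]. split.
  - rewrite comp_assoc, Hc, <- comp_assoc. now apply zero_mor_comp_l.
  - intros X x Hx.
    destruct (zero_mor_exists C HZ X B) as (o & Ho).
    assert (E : f ∘ x = g ∘ o).
    { apply zero_mor_unique; [exact Hx | now apply zero_mor_comp_l]. }
    destruct (Hu X x o E) as (h & [H1 H2] & Hh).
    assert (Hzh : is_zero_mor (p2 ∘ h)) by now rewrite H2.
    destruct (Hk X h Hzh) as (u & Eu & Huu).
    exists u. split.
    + now rewrite <- comp_assoc, Eu.
    + intros u' E'. apply Huu. symmetry. apply Hh. split.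
      * now rewrite comp_assoc.
      * apply zero_mor_unique; [|exact Ho].
        rewrite comp_assoc. now apply zero_mor_comp_r.
Qed.

Lemma kernel_comp_iso (C : Category) (A A' B K : C)
  (f : Hom A B) (f' : Hom A' B) (w : Hom A A') (k : Hom K A) :
  is_iso w -> f' ∘ w = f -> is_kernel f k -> is_kernel f' (w ∘ k).
Proof.
  intros (g & Hgw & Hwg) E [Hz Hk]. split.
  - now rewrite comp_assoc, E.
  - intros X x Hx.
    destruct (Hk X (g ∘ x)) as (u & Eu & Hu).
    + now rewrite <- E, <- comp_assoc, (comp_assoc x g w), Hwg, comp_id_l.
    + exists u. split.
      * now rewrite <- comp_assoc, Eu, comp_assoc, Hwg, comp_id_l.
      * intros u' <-. apply Hu.
        now rewrite !comp_assoc, Hgw, comp_id_l.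
Qed.

Lemma kernel_restrict_mono (C : Category) (A B K M : C)
  (f : Hom A B) (m : Hom M A) (k : Hom K A) (k' : Hom K M) :
  (forall (X : C) (u v : Hom X M), m ∘ u = m ∘ v -> u = v) ->
  m ∘ k' = k -> is_kernel f k -> is_kernel (f ∘ m) k'.
Proof.
  intros Hm E [Hz Hk]. split.
  - now rewrite <- comp_assoc, E.
  - intros X x Hx. rewrite <- comp_assoc in Hx.
    destruct (Hk X (m ∘ x) Hx) as (u & Eu & Hu).
    exists u. split.
    + apply Hm. now rewrite comp_assoc, E.
    + intros u' <-. apply Hu. now rewrite comp_assoc, E.
Qed.

(** * Equalizers *)

(** The equalizer of [x] and [y] is the pullback of their graphs
    [(1, x), (1, y) : A -> A × X], the product being a pullback over a zero
    object. *)
Lemma equalizer_exists (C : Category) (HZ : pointed C)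
  (HL : has_finite_limits C) (A X : C) (x y : Hom A X) :
  exists (M : C) (m : Hom M A),
    x ∘ m = y ∘ m /\
    (forall (T : C) (u v : Hom T M), m ∘ u = m ∘ v -> u = v) /\
    (forall (T : C) (t : Hom T A), x ∘ t = y ∘ t -> exists u, m ∘ u = t).
Proof.
  destruct HZ as (Z & _ & HT).
  destruct (HT A) as (a & _ & Ha), (HT X) as (b & _ & _).
  destruct (pullback_exists a b HL) as (Q & [q1 q2] & _ & Hq). cbn in Hq.
  assert (Hgraph : forall z : Hom A X, a ∘ idm A = b ∘ z).
  { intros z. transitivity a; [symmetry|]; now apply Ha. }
  destruct (Hq A (idm A) x (Hgraph x)) as (gx & [Gx1 Gx2] & _).
  destruct (Hq A (idm A) y (Hgraph y)) as (gy & [Gy1 Gy2] & _).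
  destruct (pullback_exists gx gy HL) as (M & [m m'] & Hc & Hu).
  cbn in Hc, Hu.
  (* The first components of the graphs are identities, so the two projections
     of [M] coincide. *)
  assert (Em : m = m').
  { transitivity (q1 ∘ gx ∘ m); [now rewrite Gx1, comp_id_l|].
    now rewrite <- comp_assoc, Hc, comp_assoc, Gy1, comp_id_l. }
  subst m'. exists M, m. split; [|split].
  - now rewrite <- Gx2, <- Gy2, <- !comp_assoc, Hc.
  - intros T u v E.
    assert (Ev : gx ∘ (m ∘ v) = gy ∘ (m ∘ v)) by now rewrite !comp_assoc, Hc.
    destruct (Hu T _ _ Ev) as (h & _ & Hh).
    transitivity h; [symmetry|]; now apply Hh.
  - intros T t E.
    assert (Et : gx ∘ t = gy ∘ t).
    { assert (Ex : a ∘ t = b ∘ (x ∘ t)).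
      { rewrite comp_assoc, <- (Hgraph x). now rewrite comp_id_r. }
      destruct (Hq T t (x ∘ t) Ex) as (h & _ & Hh).
      transitivity h; [symmetry|]; apply Hh; rewrite !comp_assoc.
      - now rewrite Gx1, Gx2, comp_id_l.
      - now rewrite Gy1, Gy2, comp_id_l, E. }
    destruct (Hu T t t Et) as (h & [Eh _] & _). now exists h.
Qed.

(** * The short five lemma and protomodularity *)

Lemma pullback_functor_pb1 (C : Category) (HL : has_finite_limits C)
  (B' B : C) (v : Hom B' B) (a b : Point B) (w : PtHom a b) :
  pb1 HL (pt_p b) v ∘ pt_mor (pb_point_map HL v w)
  = pt_mor w ∘ pb1 HL (pt_p a) v.
Proof. apply pb_lift1. Qed.

Lemma is_iso_Pt (C : Category) (B : C) (a b : Point B) (w : PtHom a b) :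
  @is_iso (Pt B) a b w <-> is_iso (pt_mor w).
Proof.
  split.
  - intros (g & H1 & H2). exists (pt_mor g). split.
    + exact (f_equal (@pt_mor C B a a) H1).
    + exact (f_equal (@pt_mor C B b b) H2).
  - intros (g & H1 & H2).
    assert (Hp : pt_p a ∘ g = pt_p b).
    { now rewrite <- (pt_mor_p w), <- comp_assoc, H2, comp_id_r. }
    assert (Hs : g ∘ pt_s b = pt_s a).
    { now rewrite <- (pt_mor_s w), comp_assoc, H1, comp_id_l. }
    exists (@Build_PtHom C B b a g Hp Hs).
    split; apply PtHom_eq; assumption.
Qed.

Lemma short_five_protomodular (C : Category) (HZ : pointed C)
  (HL : has_finite_limits C) :
  short_five (@split_epi C) -> protomodular HL.
Proof.
  intros H5 B' B v a b w Hw. cbn in a, b, w.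
  apply is_iso_Pt in Hw. apply is_iso_Pt.
  change (is_iso (pt_mor (pb_point_map HL v w))) in Hw.
  destruct (kernel_exists C HZ HL _ _ (pb2 HL (pt_p a) v)) as (K & k & Hk).
  apply (H5 _ _ B K (pt_p a) (pt_p b)
    (pb1 HL (pt_p a) v ∘ k)
    (pb1 HL (pt_p b) v ∘ (pt_mor (pb_point_map HL v w) ∘ k))).
  - exists (pt_s a). apply pt_ps.
  - exists (pt_s b). apply pt_ps.
  - exact (kernel_of_pullback C HZ _ _ _ _ _ _ _ _ _ _
             (pb_is_pullback HL (pt_p a) v) Hk).
  - apply (kernel_of_pullback C HZ _ _ _ _ _ _ _ _ _ _
             (pb_is_pullback HL (pt_p b) v)).
    apply (kernel_comp_iso C _ _ _ _ (pb2 HL (pt_p a) v));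
      [exact Hw | | exact Hk].
    exact (pt_mor_p (pb_point_map HL v w)).
  - now rewrite !comp_assoc, pullback_functor_pb1.
  - apply pt_mor_p.
Qed.

(** The domain of the pullback of a point [(A, p, s)] along [0 -> B] is a kernel
    of [p], and kernels are unique up to isomorphism. *)
Lemma pullback_functor_zero_iso (C : Category) (HL : has_finite_limits C)
  (Z B K : C) (v : Hom Z B) (a b : Point B) (w : PtHom a b)
  (k : Hom K (pt_ob a)) :
  is_zero_object Z -> is_kernel (pt_p a) k ->
  is_kernel (pt_p b) (pt_mor w ∘ k) ->
  is_iso (pt_mor (pb_point_map HL v w)).
Proof.
  intros HZ Ha Hb.
  pose proof (zero_mor_from_zero C Z B v HZ) as Hv.
  pose proof (pb_is_pullback HL (pt_p a) v) as [Ca _].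
  pose proof (pb_is_pullback HL (pt_p b) v) as [Cb _].
  destruct (proj2 Ha _ (pb1 HL (pt_p a) v)) as (t & Et & _).
  { rewrite Ca. now apply zero_mor_comp_r. }
  destruct (proj2 Hb _ (pb1 HL (pt_p b) v)) as (u & Eu & _).
  { rewrite Cb. now apply zero_mor_comp_r. }
  assert (E : pt_p a ∘ (k ∘ u) = v ∘ pb2 HL (pt_p b) v).
  { apply zero_mor_unique; [|now apply zero_mor_comp_r].
    rewrite comp_assoc. apply zero_mor_comp_r. exact (proj1 Ha). }
  exists (pb_lift HL E). split.
  - assert (Etu : u ∘ pt_mor (pb_point_map HL v w) = t).
    { apply (kernel_mono C _ _ _ _ _ _ _ _ Hb).
      rewrite (comp_assoc _ u), Eu, pullback_functor_pb1, <- comp_assoc.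
      f_equal. symmetry. exact Et. }
    apply pb_ext; rewrite comp_assoc, comp_id_r.
    + rewrite pb_lift1, <- comp_assoc.
      etransitivity; [|exact Et]. f_equal. exact Etu.
    + rewrite pb_lift2. exact (pt_mor_p (pb_point_map HL v w)).
  - apply pb_ext; rewrite comp_assoc, comp_id_r.
    + rewrite pullback_functor_pb1, <- comp_assoc, <- Eu, <- (comp_assoc u).
      f_equal. exact (pb_lift1 HL E).
    + etransitivity; [|exact (pb_lift2 HL E)].
      f_equal. exact (pt_mor_p (pb_point_map HL v w)).
Qed.

Lemma protomodular_short_five (C : Category) (HZ : pointed C)
  (HL : has_finite_limits C) :
  protomodular HL -> short_five (@split_epi C).
Proof.
  intros HP A A' B K f f' k k' w [s Hs] _ Hk Hk' Ek Ef.
  (* A morphism over [B] need not respect given sections, so [f'] is equipped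
     with the image of the section of [f]. *)
  assert (Hs' : f' ∘ (w ∘ s) = idm B) by now rewrite comp_assoc, Ef.
  pose (a := @Build_Point C B A f s Hs).
  pose (b := @Build_Point C B A' f' (w ∘ s) Hs').
  pose (W := @Build_PtHom C B a b w Ef eq_refl).
  destruct HZ as (Z & HZ). destruct (proj1 HZ B) as (v & _ & _).
  apply (is_iso_Pt C B a b W), (HP Z B v a b W).
  apply is_iso_Pt.
  apply (pullback_functor_zero_iso C HL Z B K v a b W k HZ Hk).
  cbn. now rewrite Ek.
Qed.

(** * Split epimorphisms are cokernels of their kernels *)

(** The kernel and the section are jointly epimorphic: their joint factorization
    through an equalizer forces it to be invertible. *)
Lemma kernel_section_jointly_epi (C : Category) (HZ : pointed C)
  (HL : has_finite_limits C) (H5 : short_five (@split_epi C))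
  (A B K X : C) (f : Hom A B) (s : Hom B A) (k : Hom K A) (x y : Hom A X) :
  f ∘ s = idm B -> is_kernel f k -> x ∘ k = y ∘ k -> x ∘ s = y ∘ s -> x = y.
Proof.
  intros Hs Hk Exk Exs.
  destruct (equalizer_exists C HZ HL A X x y) as (M & m & Em & Hm & Hl).
  destruct (Hl _ _ Exk) as (k' & Ek'), (Hl _ _ Exs) as (s' & Es').
  assert (Hiso : is_iso m).
  { apply (H5 M A B K (f ∘ m) f k' k m).
    - exists s'. now rewrite <- comp_assoc, Es'.
    - now exists s.
    - now apply (kernel_restrict_mono C _ _ _ _ f m k k').
    - exact Hk.
    - exact Ek'.
    - reflexivity. }
  destruct Hiso as (g & _ & Hmg).
  now rewrite <- (comp_id_r x), <- (comp_id_r y), <- Hmg, !comp_assoc, Em.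
Qed.

Lemma split_epi_normal (C : Category) (HZ : pointed C)
  (HL : has_finite_limits C) (H5 : short_five (@split_epi C))
  (A B : C) (f : Hom A B) :
  split_epi f -> normal_epi f.
Proof.
  intros [s Hs].
  destruct (kernel_exists C HZ HL A B f) as (K & k & Hk).
  exists K, k. split; [exact (proj1 Hk)|].
  intros X x Hx. exists (x ∘ s). split.
  - apply (kernel_section_jointly_epi C HZ HL H5 A B K X f s k _ _ Hs Hk).
    + apply zero_mor_unique; [|exact Hx].
      rewrite <- comp_assoc. apply zero_mor_comp_l, Hk.
    + now rewrite <- comp_assoc, Hs, comp_id_r.
  - intros u <-. now rewrite <- comp_assoc, Hs, comp_id_r.
Qed.

(** * The equivalence *)

Lemma iso_split_epi (C : Category) (A B : C) (f : Hom A B) :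
  is_iso f -> split_epi f.
Proof. intros (g & _ & H). now exists g. Qed.

Lemma split_epi_pullback (C : Category) (A B D P : C) (f : Hom A D)
  (g : Hom B D) (p1 : Hom P A) (p2 : Hom P B) :
  is_pullback f g p1 p2 -> split_epi f -> split_epi p2.
Proof.
  intros [_ Hu] [s Hs].
  destruct (Hu B (s ∘ g) (idm B)) as (h & [_ Hh] & _).
  - now rewrite comp_assoc, Hs, comp_id_l, comp_id_r.
  - now exists h.
Qed.

Theorem proposition3p1 (C : Category) (HZ : pointed C)
    (HL : has_finite_limits C) (HC : has_cokernels C) :
  relative_weakly_homological (@split_epi C) <-> protomodular HL.
Proof.
  split.
  - intros H. now apply short_five_protomodular, rwh_short_five.
  - intros HP. pose proof (protomodular_short_five C HZ HL HP) as H5. split.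
    + exact (@iso_split_epi C).
    + exact (@split_epi_pullback C).
    + exact (split_epi_normal C HZ HL H5).
    + exact H5.
    + intros A B D f g [s Hs] [t Ht]. exists (s ∘ t).
      now rewrite comp_assoc, <- (comp_assoc s f g), Hs, comp_id_r.
    + intros A B D f g _ [s Hs]. exists (f ∘ s). now rewrite comp_assoc.
Qed.
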